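(* Let $G$ be a connected graph (simple, locally finite) with minimum degree $\delta$. If $G$ has non-negative Bakry-Émery curvature, then $G$ is $(\delta-1)$-edge-connected.
   Context: All graphs are simple and locally finite (every vertex has finite degree), possibly infinite. Let $G=(V,E)$ be such a graph. If $G$ has at least two vertices, it is called $l$-edge-connected if $G-F$ is connected for every set $F\subset E$ of fewer than $l$ edges (here $G-F$ is obtained from $G$ by deleting the edges in $F$ and keeping all vertices). The edge-connectivity of $G$ is the greatest integer $l$ such that $G$ is $l$-edge-connected; the edge-connectivity of a single vertex is defined to be $0$. Bakry-Émery curvature: for $f:V\to\mathbb{R}$ and $x\in V$ put $\Delta f(x):=\sum_{y\sim x}(f(y)-f(x))$, where $y\sim x$ means that $y$ is adjacent to $x$. For $f,g:V\to\mathbb{R}$ put $$\Gamma(f,g)(x):=\tfrac12\left(\Delta(fg)-(\Delta f)g-f(\Delta g)\right)(x),$$ $$\Gamma_2(f,g)(x):=\tfrac12\left(\Delta\Gamma(f,g)-\Gamma(\Delta f,g)-\Gamma(f,\Delta g)\right)(x),$$ and $\Gamma(f):=\Gamma(f,f)$, $\Gamma_2(f):=\Gamma_2(f,f)$. For $K\in\mathbb{R}$, $G$ satisfies $CD(\infty,K)$ at $x$ if $\Gamma_2(f)(x)\ge K\,\Gamma(f)(x)$ for every $f:V\to\mathbb{R}$. The Bakry-Émery curvature of $G$ at $x$ is $K_{BE}(G,x):=\sup\{K: G\text{ satisfies }CD(\infty,K)\text{ at }x\}$, and the Bakry-Émery curvature of $G$ is $K_{BE}(G):=\inf_{x\in V}K_{BE}(G,x)$.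 Non-negative Bakry-Émery curvature means $K_{BE}(G)\ge 0$, equivalently $G$ satisfies $CD(\infty,0)$ at every vertex. *)

(* Defs.v *)
From HB Require Import structures.
From mathcomp Require Import all_boot all_order all_algebra.
From mathcomp Require Import finmap.
From mathcomp Require Import boolp classical_sets functions cardinality fsbigop.
From mathcomp Require Import reals constructive_ereal ereal.

Set Implicit Arguments.
Unset Strict Implicit.
Unset Printing Implicit Defensive.

Import Order.TTheory GRing.Theory Num.Theory.

Local Open Scope classical_set_scope.
Local Open Scope ring_scope.

Record graph (V : choiceType) := Graph {
  adj : rel V;
  adj_sym : symmetric adj;
  adj_irr : irreflexive adj;
  adj_fin : forall x, finite_set [set y | adj x y]
}.

Section Graphs.
Variables (V : choiceType) (G : graph V).

Definition neighbors (x : V) : set V := [set y | adj G x y].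

Definition degree (x : V) : nat := #|` fset_set (neighbors x)|%fset.

Definition is_min_degree (delta : nat) : Prop :=
  (exists x, degree x = delta) /\ (forall x, (delta <= degree x)%N).

Definition graph_connected : Prop :=
  forall x y, exists2 p, path (adj G) x p & last x p = y.

(* An edge is the unordered pair of its endpoints. *)
Definition edges : set {fset V} :=
  [set e | exists x y, adj G x y /\ e = [fset x; y]%fset].

Definition del_adj (F : {fset {fset V}}) : rel V :=
  fun x y => adj G x y && ([fset x; y]%fset \notin F).

Lemma del_adj_sym F : symmetric (del_adj F).
Proof. by move=> x y; rewrite /del_adj adj_sym fsetUC. Qed.

Lemma del_adj_irr F : irreflexive (del_adj F).
Proof. by move=> x; rewrite /del_adj adj_irr. Qed.

Lemma del_adj_fin F x : finite_set [set y | del_adj F x y].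
Proof. by apply: sub_finite_set (adj_fin G x) => y /= /andP[]. Qed.

Definition del_edges (F : {fset {fset V}}) : graph V :=
  Graph (del_adj_sym F) (del_adj_irr F) (@del_adj_fin F).

End Graphs.

(* A set of fewer than l edges is finite, so F may range over finite sets.
   A single vertex has edge-connectivity 0, hence is l-edge-connected only
   for l = 0. *)
Definition edge_connected (V : choiceType) (G : graph V) (l : nat) : Prop :=
  ((exists x y : V, x != y) ->
     forall F : {fset {fset V}},
       [set` F] `<=` edges G -> (#|` F|%fset < l)%N ->
       graph_connected (del_edges G F))
  /\ ((forall x y : V, x = y) -> l = 0%N).

Section Curvature.
Variables (R : realType) (V : choiceType) (G : graph V).
Implicit Types (f g : V -> R) (x : V).

Definition laplacian f x : R := \sum_(y \in neighbors G x) (f y - f x).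

Definition Gamma f g x : R :=
  2^-1 * (laplacian (f \* g) x - laplacian f x * g x - f x * laplacian g x).

Definition Gamma2 f g x : R :=
  2^-1 * (laplacian (Gamma f g) x - Gamma (laplacian f) g x
          - Gamma f (laplacian g) x).

Definition CD (K : R) x : Prop := forall f, K * Gamma f f x <= Gamma2 f f x.

(* Extended-real valued: at an isolated vertex every K is admissible and the
   curvature is +oo. *)
Definition curvature_at x : \bar R := ereal_sup [set K%:E | K in [set K | CD K x]].

Definition curvature : \bar R := ereal_inf (range curvature_at).

End Curvature.

(* Main.v *)
Require Import Defs.
From mathcomp Require Import all_boot all_order all_algebra.
From mathcomp Require Import boolp classical_sets functions cardinality fsbigop.
From mathcomp Require Import reals constructive_ereal ereal.
From mathcomp Require Import finmap ring lra zify.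

Set Implicit Arguments.
Unset Strict Implicit.
Unset Printing Implicit Defensive.

(** Suppose that deleting a set F of at most delta - 2 edges disconnects G.  The
vertices reachable from some vertex of G - F form a set S with S and its
complement nonempty, and every edge between the two belongs to F.  The cross
degree of a vertex is the number of its neighbours on the other side of S.  It
is bounded by #|F|, so some vertex x maximises it; let a >= 1 be the maximum.
A function f with Gamma_2(f)(x) < 0 is then built from the cut.

When f(x) = 0, [Gamma2E] expresses 4 Gamma_2(f)(x) as
  sum_(y ~ x) sum_(z ~ y) ((f z - 2 f y)^2 - f(y)^2)
    - deg(x) sum_(y ~ x) f(y)^2 + 2 (sum_(y ~ x) f y)^2.
Let A and B be the neighbours of x across the cut and on the side of x, with
#|A| = a and #|B| = b.  Ideally f is 1 on A, -t on B, and at distance two from x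
it is 2 across the cut and -2t on the side of x.  An edge yz away from the cut,
with y ~ x and z at distance two, then contributes -f(y)^2; among the edges that
do not contain x, only those of the cut contribute a positive amount.  Since all degrees are at least delta,
there are many edges of the first kind; there are at most delta - 2 - a edges in
the cut besides those at x.

- If a >= 3, this f with t = a/b, for which the values of f around x sum to 0,
  already gives a negative value ([excess3]).
- If a = 2, the estimate has to be sharper.  The maximality of a shows that at
  most two further edges of the cut meet A.  The vertices of B adjacent to A get
  -t/2, the vertices across the cut at distance two that are adjacent to B get 1,
  the far vertices on the side of x get -3t/2, and t = 2/b ([excess2]).
- If a = 1, no other edge of the cut meets A.  The same f at t = 0 may give
  exactly 0, but the derivative in t is negative there, so t = 1/b^2 works
  ([excess1]).

[Gamma2_test] bounds 4 Gamma_2(f)(x) by a polynomial, [excess], in the numbers of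
edges of the various kinds, simultaneously for these choices of f. *)

(** * The curvature form at a vertex *)

Section Curv.
Import Order.TTheory GRing.Theory Num.Theory.
Local Open Scope ring_scope.
Variables (R : realType) (V : choiceType) (G : graph V).
Implicit Types (f g : V -> R) (x y z : V).

(** The neighbours of x, as a duplicate-free sequence. *)
Definition nbrs x : seq V := fset_set (neighbors G x).

Lemma mem_nbrs x y : (y \in nbrs x) = adj G x y.
Proof.
rewrite /nbrs in_fset_set; last exact: adj_fin.
by apply/idP/idP => [/set_mem//|h]; apply/mem_set.
Qed.

Lemma nbrs_uniq x : uniq (nbrs x).
Proof. exact: fset_uniq. Qed.

Lemma size_nbrs x : size (nbrs x) = degree G x.
Proof. by []. Qed.

Lemma laplacianE f x : laplacian G f x = \sum_(y <- nbrs x) (f y - f x).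
Proof. by rewrite /laplacian fsbig_finite //=; exact: adj_fin. Qed.

Lemma GammaE f g x :
  Gamma G f g x = 2^-1 * \sum_(y <- nbrs x) (f y - f x) * (g y - g x).
Proof.
rewrite /Gamma !laplacianE; congr (_ * _).
rewrite mulr_suml mulr_sumr -!sumrB; apply: eq_bigr => y _ /=; ring.
Qed.

(** Subtracting a constant from f does not change Gamma_2(f), so f x = 0 is no
loss of generality; it makes Gamma_2(f)(x) a quadratic form in the values of f
at distance one and two from x. *)
Lemma Gamma2E f x : f x = 0 ->
  4 * Gamma2 G f f x =
    \sum_(y <- nbrs x) \sum_(z <- nbrs y) ((f z - 2 * f y) ^+ 2 - f y ^+ 2)
    - (degree G x)%:R * \sum_(y <- nbrs x) f y ^+ 2
    + 2 * (\sum_(y <- nbrs x) f y) ^+ 2.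
Proof.
move=> fx.
set s1 := \sum_(y <- nbrs x) f y; set s2 := \sum_(y <- nbrs x) f y ^+ 2.
pose T := \sum_(y <- nbrs x) \sum_(z <- nbrs y) (f z - f y) ^+ 2.
pose U := \sum_(y <- nbrs x) \sum_(z <- nbrs y) f y * (f z - f y).
have E0 : laplacian G f x = s1.
  by rewrite laplacianE; under eq_bigr do rewrite fx subr0.
have E1 : Gamma G f f x = 2^-1 * s2.
  by rewrite GammaE; congr (_ * _); apply: eq_bigr => y _; rewrite fx subr0.
have E2 : laplacian G (Gamma G f f) x = 2^-1 * (T - (degree G x)%:R * s2).
  rewrite laplacianE sumrB E1 big_const_seq count_predT size_nbrs iter_addr_0.
  rewrite mulrBr; congr (_ - _).
    by rewrite mulr_sumr; under eq_bigr do rewrite GammaE.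
  by rewrite -[LHS]mulr_natl mulrCA.
have E3 : \sum_(y <- nbrs x) f y * (laplacian G f y - laplacian G f x) = U - s1 ^+ 2.
  rewrite expr2 mulr_suml -sumrB; apply: eq_bigr => y _.
  by rewrite mulrBr E0 laplacianE mulr_sumr.
have E4 : Gamma G f (laplacian G f) x = 2^-1 * (U - s1 ^+ 2).
  by rewrite -E3 GammaE; congr (_ * _); apply: eq_bigr => y _; rewrite fx subr0.
have E5 : Gamma G (laplacian G f) f x = 2^-1 * (U - s1 ^+ 2).
  by rewrite -E4 !GammaE; congr (_ * _); apply: eq_bigr => y _; rewrite mulrC.
have -> : \sum_(y <- nbrs x) \sum_(z <- nbrs y) ((f z - 2 * f y) ^+ 2 - f y ^+ 2)
    = T - 2 * U.
  rewrite mulr_sumr -sumrB; apply: eq_bigr => y _.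
  by rewrite mulr_sumr -sumrB; apply: eq_bigr => z _; ring.
by rewrite /Gamma2 E2 E4 E5; field.
Qed.

Lemma Gamma_ge0 f x : 0 <= Gamma G f f x.
Proof.
rewrite GammaE mulr_ge0 ?invr_ge0// sumr_ge0// => y _; exact: sqr_ge0.
Qed.

Lemma curvature_ge0_Gamma2 : (0%:E <= curvature R G)%E ->
  forall f x, 0 <= Gamma2 G f f x.
Proof.
move=> h f x; rewrite leNgt; apply/negP => hlt.
have hx : (0%:E <= curvature_at R G x)%E.
  by apply: (le_trans h); apply: ereal_inf_lbound; exists x.
(* If Gamma f vanishes at x, any admissible K will do; otherwise K is taken
   larger than the negative quotient Gamma2 f / Gamma f. *)
have [G0|G0] := eqVneq (Gamma G f f x) 0.
  have : (-oo < curvature_at R G x)%E by apply: lt_le_trans hx; exact: ltNyr.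
  move=> /ereal_sup_gt[_ [K /= hK _] _].
  by have := hK f; rewrite G0 mulr0 leNgt hlt.
have Gp : 0 < Gamma G f f x by rewrite lt_neqAle eq_sym G0 Gamma_ge0.
set e := Gamma2 G f f x / Gamma G f f x.
have e0 : e < 0 by rewrite pmulr_llt0 ?invr_gt0.
have : (e%:E < curvature_at R G x)%E by apply: lt_le_trans hx; rewrite lte_fin.
move=> /ereal_sup_gt[_ [K /= hK <-]]; rewrite lte_fin => eK.
have := hK f; rewrite leNgt => /negP; apply.
by rewrite -ltr_pdivrMr.
Qed.
End Curv.

(** * Counting around a vertex of a cut *)

Section Cut.
Variables (V : choiceType) (G : graph V) (S : pred V) (x : V).
Local Notation N := (nbrs G).

(** The predicate S is one side of the cut.  Relative to the vertex x, A consists of the neighbours of x across the cut, B of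
the neighbours on the side of x, and the far vertices are those which are neither
x nor a neighbour of x. *)
Definition across := fun z => S z != S x.
Definition inA := fun z => (z \in N x) && across z.
Definition inB := fun z => (z \in N x) && ~~ across z.
Definition farX := fun z => [&& z \notin N x, ~~ across z & z != x].
Definition farY := fun z => (z \notin N x) && across z.

(** Adjacency to some vertex of A, respectively of B. *)
Definition touching := fun z => has (fun y => across y && adj G z y) (N x).
Definition facing := fun z => has (fun w => ~~ across w && adj G z w) (N x).

(** The number of neighbours of v on the other side of the cut. *)
Definition cross_deg v := count (fun z => S z != S v) (N v).

(** The cardinal of B, and of the set B0 of the vertices of B adjacent to A. *)
Definition same_deg := count (fun z => ~~ across z) (N x).
Definition same_deg0 := count (fun z => ~~ across z && touching z) (N x).

(** The numbers of edges of the cut between A and B, between A and the far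
vertices on the side of x, and between B and the far vertices across the cut. *)
Definition edgesAB := \sum_(y <- N x | across y) count inB (N y).
Definition edgesAX := \sum_(y <- N x | across y) count farX (N y).
Definition edgesBY := \sum_(w <- N x | ~~ across w) count farY (N w).

Lemma cross_same_deg : cross_deg x + same_deg = degree G x.
Proof. by rewrite /cross_deg /same_deg count_predC size_nbrs. Qed.

(** Counting the common neighbours of x and y from either side. *)
Lemma count_nbrsC (P : pred V) y :
  count (fun z => (z \in N x) && P z) (N y) =
  count (fun z => adj G y z && P z) (N x).
Proof.
rewrite -!size_filter; apply/perm_size/uniq_perm; rewrite ?filter_uniq ?nbrs_uniq//.
move=> z; rewrite !mem_filter !mem_nbrs.
by case: (adj G y z); case: (adj G x z); rewrite ?andbF.
Qed.

Lemma edgesABC : \sum_(w <- N x | ~~ across w) count inA (N w) = edgesAB.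
Proof.
rewrite /edgesAB.
under eq_bigr do rewrite count_nbrsC -sum1_count.
under [RHS]eq_bigr do rewrite count_nbrsC -sum1_count.
rewrite (exchange_big_dep across) /=; last by move=> w y _ /andP[].
apply: eq_bigr => y oy; rewrite -big_filter -[RHS]big_filter.
congr (\sum_(_ <- _) _); apply: eq_filter => w /=.
by rewrite oy andbT adj_sym andbC.
Qed.

Lemma same_deg0_le : same_deg0 <= same_deg.
Proof. by apply: sub_count => z /andP[]. Qed.

Lemma same_deg0_le_edgesAB : same_deg0 <= edgesAB.
Proof.
rewrite -edgesABC /same_deg0 -sum1_count big_mkcondr /=.
apply: leq_sum => w _; case: ifP => // /hasP[y yN /andP[oy wy]].
by rewrite -has_count; apply/hasP; exists y; rewrite ?mem_nbrs // /inA yN.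
Qed.

Lemma count_inA y : y \in N x -> across y -> count inA (N y) < cross_deg x.
Proof.
move=> yN oy; rewrite /cross_deg -!size_filter.
have -> : (size [seq x <- N y | inA x]).+1 = size (y :: [seq x <- N y | inA x]) by [].
apply: uniq_leq_size => [|z].
  by rewrite /= filter_uniq ?nbrs_uniq// mem_filter mem_nbrs adj_irr andbF.
rewrite in_cons !mem_filter => /orP[/eqP->|/andP[/andP[zN oz] _]]; exact/andP.
Qed.

Lemma count_inB w : w \in N x -> ~~ across w -> count inB (N w) < same_deg.
Proof.
move=> yN oy; rewrite /same_deg -!size_filter.
have -> : (size [seq x <- N w | inB x]).+1 = size (w :: [seq x <- N w | inB x]) by [].
apply: uniq_leq_size => [|z].
  by rewrite /= filter_uniq ?nbrs_uniq// mem_filter mem_nbrs adj_irr andbF.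
rewrite in_cons !mem_filter => /orP[/eqP->|/andP[/andP[zN oz] _]]; exact/andP.
Qed.

Lemma count_B0 w : count (fun z => inB z && touching z) (N w) <= same_deg0.
Proof.
rewrite /same_deg0 -!size_filter; apply: uniq_leq_size => [|z].
  by rewrite filter_uniq ?nbrs_uniq.
by rewrite !mem_filter => /andP[/andP[/andP[zN oz] tz] _]; rewrite zN andbT; exact/andP.
Qed.

(** A far vertex across the cut that is adjacent to B has at most #|A| neighbours
in A, and there are at most [edgesBY] such vertices. *)
Lemma count_facing :
  \sum_(y <- N x | across y) count (fun z => farY z && facing z) (N y)
  <= cross_deg x * edgesBY.
Proof.
rewrite /cross_deg -sum1_count big_distrl /=; apply: leq_sum => y oy; rewrite mul1n.
apply: (@leq_trans (\sum_(w <- N x | ~~ across w)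
                    count (fun z => farY z && adj G z w) (N y))).
  under eq_bigr do rewrite -sum1_count big_mkcond.
  rewrite exchange_big -sum1_count big_mkcond; apply: leq_sum => z _ /=.
  case: ifP => // /andP[fz /hasP[w wN /andP[ow zw]]].
  rewrite -big_mkcondr sum1_count -has_count; apply/hasP; exists w => //=.
  by rewrite ow fz.
apply: leq_sum => w ow; rewrite -!size_filter; apply: uniq_leq_size => [|z].
  by rewrite filter_uniq ?nbrs_uniq.
by rewrite !mem_filter !mem_nbrs => /andP[/andP[-> zw] _]; rewrite adj_sym.
Qed.

Lemma cross_degA y : y \in N x -> across y ->
  cross_deg y = (count inB (N y) + count farX (N y)).+1.
Proof.
rewrite mem_nbrs adj_sym -mem_nbrs => xN oy.
have <- : count (pred1 x) (N y) + (count inB (N y) + count farX (N y)) =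
          (count inB (N y) + count farX (N y)).+1.
  by rewrite count_uniq_mem ?nbrs_uniq // xN.
rewrite /cross_deg -!sum1_count !(big_mkcond (fun _ => _ _)) -!big_split /=.
apply: eq_bigr => z _; rewrite /inB /farX.
have -> : (S z != S y) = ~~ across z by move: oy; rewrite /across; do 3!case: (S _).
have [->|zx] := eqVneq z x; last by case: (z \in N x); case: (across z).
by rewrite mem_nbrs adj_irr /across eqxx.
Qed.

(** The edges of the cut that meet A, counted by their endpoint in A; those at x
are counted by [cross_deg x]. *)
Lemma sum_cross_deg :
  cross_deg x + (edgesAB + edgesAX) = \sum_(y <- N x | across y) cross_deg y.
Proof.
rewrite /edgesAB /edgesAX {1}/cross_deg -sum1_count -!big_split /=.
rewrite -[LHS]big_filter -[RHS]big_filter.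
apply: eq_big_seq => y; rewrite mem_filter => /andP[oy yN].
by rewrite (cross_degA yN oy).
Qed.

(** Each vertex of A has x among its neighbours on the side of x, whence the
predecessor. *)
Lemma edgesA_le : (forall y, y \in N x -> cross_deg y <= cross_deg x) ->
  edgesAB + edgesAX <= cross_deg x * (cross_deg x).-1.
Proof.
move=> hmax.
have [/eqP c0|c0] := posnP (cross_deg x).
  have := sum_cross_deg; rewrite -big_filter.
  move: c0; rewrite /cross_deg -leqn0 leqNgt -has_count => /negPf.
  by rewrite has_filter => /negbFE/eqP ->; rewrite big_nil; lia.
rewrite -(leq_add2l (cross_deg x)) -mulnS prednK // sum_cross_deg.
have -> : cross_deg x * cross_deg x = \sum_(y <- N x | across y) cross_deg x.
  by rewrite {1}/cross_deg -sum1_count big_distrl /=; under eq_bigr do rewrite mul1n.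
rewrite -big_filter -[X in _ <= X]big_filter !big_seq.
by apply: leq_sum => y; rewrite mem_filter => /andP[_ /hmax].
Qed.

(** Every edge counted by [cross_deg x], [edgesAB], [edgesAX] and [edgesBY] belongs
to the cut, and none is counted twice. *)
Lemma cut_card (F : {fset {fset V}}) :
  (forall y z, adj G y z -> S y != S z -> [fset y; z]%fset \in F) ->
  cross_deg x + (edgesAB + edgesAX) + edgesBY <= #|` F|%fset.
Proof.
move=> hF; rewrite sum_cross_deg.
(* These edges are listed as pairs whose first component is the endpoint across
   the cut, so that distinct pairs give distinct unordered pairs. *)
pose LA := [seq (y, z) | y <- [seq y <- N x | across y],
                         z <- [seq z <- N y | S z != S y]].
pose LB := [seq (z, w) | w <- [seq w <- N x | ~~ across w],
                         z <- [seq z <- N w | farY z]].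
have -> : \sum_(y <- N x | across y) cross_deg y + edgesBY = size (LA ++ LB).
  rewrite size_cat !size_allpairs_dep !sumnE !big_map !big_filter.
  by congr (_ + _); apply: eq_bigr => y _; rewrite size_filter.
have side p : p \in LA ++ LB -> [/\ adj G p.1 p.2, S p.1 != S x & S p.2 = S x].
  rewrite mem_cat => /orP[] /allpairsPdep[y [z []]].
    rewrite !mem_filter !mem_nbrs => /andP[oy _] /andP[sz zy] -> /=.
    by split=> //; move: oy sz; rewrite /across; do 3!case: (S _).
  rewrite !mem_filter !mem_nbrs => /andP[/negPn/eqP oy _] /andP[/andP[_ sz] zy] -> /=.
  by rewrite adj_sym.
have uL : uniq (LA ++ LB).
  rewrite cat_uniq !allpairs_uniq_dep ?filter_uniq ?nbrs_uniq //=.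
  - rewrite andbT; apply/hasPn => p /allpairsPdep[w [z []]].
    rewrite !mem_filter => _ /andP[/andP[zN _] _] ->.
    apply/negP => /allpairsPdep[y [z' []]].
    by rewrite mem_filter => /andP[_ yN] _ [zy _]; rewrite zy yN in zN.
  - by move=> w _; rewrite filter_uniq ?nbrs_uniq.
  - by move=> [w z] [w' z'] _ _ /= [-> ->].
  - by move=> w _; rewrite filter_uniq ?nbrs_uniq.
  - by move=> [w z] [w' z'] _ _ /= [-> ->].
rewrite -(size_map (fun p => [fset p.1; p.2]%fset)).
apply: uniq_leq_size => [|e /mapP[p /side[h1 h2 h3] ->]]; last first.
  by apply: hF => //; rewrite h3.
rewrite map_inj_in_uniq // => -[y z] [y' z'] /side[/= _ oy sz] /side[/= _ oy' sz'].
move/fsetP => h.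
have := h y; have := h z; rewrite !in_fset2 !eqxx orbT /=.
move=> /esym/orP[/eqP zz|/eqP ->]; first by move: oy'; rewrite -zz sz eqxx.
by move=> /esym/orP[/eqP -> //|/eqP zz]; move: oy; rewrite zz sz' eqxx.
Qed.

(** * The test functions *)

Import Order.TTheory GRing.Theory Num.Theory.
Local Open Scope ring_scope.
Variable R : realType.

(** The bound for 4 Gamma_2(f)(x) when f is the function [test] below with
parameters t, u, m, r.  The vertex x has a neighbours in A and b in B, of which
b0 are adjacent to A; c1, c2, c3 stand for [edgesAB], [edgesAX], [edgesBY], and de
is a lower bound of all degrees. *)
Definition excess (a b b0 c1 c2 c3 de t u m r : R) : R :=
  let r0 := u ^+ 2 - (2 * u - r) ^+ 2 in
  let r1 := t ^+ 2 - (2 * t - r) ^+ 2 in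
  a * (3 - de + a) + c1 * (2 + u) ^+ 2 + c2 * (2 + r) ^+ 2
  + (m - 2) ^+ 2 * (a * c3)
  + b0 * (3 * u ^+ 2 - r0 * (de - b))
  + (b - b0) * (3 * t ^+ 2 - r1 * (de - b)
                + b0 * ((2 * t - u) ^+ 2 - t ^+ 2))
  + c1 * ((1 + 2 * u) ^+ 2 - u ^+ 2 + r0)
  + c3 * ((m + 2 * t) ^+ 2 - t ^+ 2 + r1)
  - (a + b) * (a + b0 * u ^+ 2 + (b - b0) * t ^+ 2)
  + 2 * (a - b0 * u - (b - b0) * t) ^+ 2.

Lemma sum_indicator (s : seq V) (P : pred V) :
  \sum_(z <- s) (P z)%:R = (count P s)%:R :> R.
Proof.
rewrite -sum1_count natr_sum [RHS]big_mkcond; apply: eq_bigr => z _; by case: (P z).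
Qed.

Variables (t u m r : R).

(** The test function: 0 at x, 1 on A, -u on B0, -t on the rest of B; among the far
vertices, -r on the side of x, and across the cut m next to B and 2 elsewhere. *)
Definition test z : R :=
  if z == x then 0
  else if z \in N x then
    (if across z then 1 else if touching z then - u else - t)
  else if across z then (if facing z then m else 2) else - r.

Lemma nbr_neq z : z \in N x -> (z == x) = false.
Proof. by move=> zN; apply/eqP => zx; rewrite zx mem_nbrs adj_irr in zN. Qed.

Lemma testx : test x = 0. Proof. by rewrite /test eqxx. Qed.

Lemma testA y : y \in N x -> across y -> test y = 1.
Proof. by move=> yN oy; rewrite /test nbr_neq // yN oy. Qed.

Lemma testB0 w : w \in N x -> ~~ across w -> touching w -> test w = - u.
Proof. by move=> yN /negPf oy ty; rewrite /test nbr_neq // yN oy ty. Qed.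

Lemma testB1 w : w \in N x -> ~~ across w -> ~~ touching w -> test w = - t.
Proof. by move=> yN /negPf oy /negPf ty; rewrite /test nbr_neq // yN oy ty. Qed.

Lemma count1_nbr y : y \in N x -> count (pred1 x) (N y) = 1%N.
Proof.
by rewrite mem_nbrs adj_sym -mem_nbrs => xN; rewrite count_uniq_mem ?nbrs_uniq // xN.
Qed.

(** The part of the quadratic form of [Gamma2E] due to the paths x - y - z. *)
Definition energy y : R :=
  \sum_(z <- N y) ((test z - 2 * test y) ^+ 2 - test y ^+ 2).

Variable de : nat.
Hypothesis hde : forall y, (de <= degree G y)%N.

Lemma sum_const_nbrs y (c : R) : \sum_(z <- N y) c = c * (degree G y)%:R.
Proof. by rewrite big_const_seq count_predT size_nbrs iter_addr_0 mulr_natr. Qed.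

(** For y in A, a neighbour z contributes (f z - 2)^2 - 1.  This is -1 for a far z
across the cut not adjacent to B; counting -1 for every neighbour and correcting
for the other ones gives the bound.  A has at most a - 1 vertices adjacent to
y, each of which contributes 0. *)
Lemma energyA y : y \in N x -> across y ->
  energy y <= 3 - de%:R + (cross_deg x)%:R + (2 + u) ^+ 2 * (count inB (N y))%:R
     + (2 + r) ^+ 2 * (count farX (N y))%:R
     + (m - 2) ^+ 2 * (count (fun z => farY z && facing z) (N y))%:R.
Proof.
move=> yN oy; rewrite /energy (testA yN oy).
rewrite (eq_big_seq (fun z => -1 + 4 * (pred1 x z)%:R + (inA z)%:R
    + (2 + u) ^+ 2 * (inB z)%:R + (2 + r) ^+ 2 * (farX z)%:R
    + (m - 2) ^+ 2 * (farY z && facing z)%:R)); last first.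
  move=> z zy; rewrite /test /inA /inB /farX /farY /=.
  have [->|zx] := eqVneq z x; first by rewrite mem_nbrs adj_irr /across eqxx /=; ring.
  have [zN|zN] := boolP (z \in N x); have [oz|oz] := boolP (across z) => /=.
  - by ring.
  - have -> : touching z; last by ring.
    by apply/hasP; exists y => //; rewrite oy adj_sym -mem_nbrs.
  - by case: (facing z) => /=; ring.
  - by ring.
rewrite !big_split /= -!mulr_sumr !sum_indicator sum_const_nbrs count1_nbr //.
have h1 : (count inA (N y))%:R + 1 <= (cross_deg x)%:R :> R.
  by rewrite natr1 ler_nat; exact: count_inA.
have h2 : de%:R <= (degree G y)%:R :> R by rewrite ler_nat.
lra.
Qed.

(** Minus the contribution of an edge from B0, respectively from the rest of B, to a
far vertex on the side of x. *)
Let r0 := u ^+ 2 - (2 * u - r) ^+ 2.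
Let r1 := t ^+ 2 - (2 * t - r) ^+ 2.

(** These inequalities on the parameters hold for all the test functions in use.
They allow degrees to be replaced by de ([r0_ge0], [r1_ge0]), edges between B0 and
the rest of B to be dropped from the energy of B0 ([ut]), the number of neighbours
in B0 to be replaced by #|B0| ([tu]), and the two parts of B to share
one coefficient for their edges to the far vertices across the cut ([cY]). *)
Hypothesis r0_ge0 : 0 <= r0.
Hypothesis r1_ge0 : 0 <= r1.
Hypothesis ut : (2 * u - t) ^+ 2 <= u ^+ 2.
Hypothesis tu : t ^+ 2 <= (2 * t - u) ^+ 2.
Hypothesis cY : (m + 2 * u) ^+ 2 - u ^+ 2 + r0 <= (m + 2 * t) ^+ 2 - t ^+ 2 + r1.

(** The two bounds for w in B arise as in [energyA]: every neighbour is counted as if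
it were a far vertex on the side of x, with -r0 or -r1, and the other ones are then
corrected. *)
Lemma energyB0 w : w \in N x -> ~~ across w && touching w ->
  energy w <= 3 * u ^+ 2 - r0 * (de%:R - same_deg%:R)
    + ((1 + 2 * u) ^+ 2 - u ^+ 2 + r0) * (count inA (N w))%:R
    + ((m + 2 * t) ^+ 2 - t ^+ 2 + r1) * (count farY (N w))%:R.
Proof.
move=> wN /andP[ow tw]; rewrite /energy (testB0 wN ow tw).
apply: (@le_trans _ _ (\sum_(z <- N w) (- r0 + (3 * u ^+ 2 + r0) * (pred1 x z)%:R
   + r0 * (inB z)%:R
   + ((1 + 2 * u) ^+ 2 - u ^+ 2 + r0) * (inA z)%:R
   + ((m + 2 * t) ^+ 2 - t ^+ 2 + r1) * (farY z)%:R))).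
  rewrite big_seq [X in _ <= X]big_seq; apply: ler_sum => z zw.
  rewrite /test /inA /inB /farX /farY /=.
  have [->|zx] := eqVneq z x; first by rewrite mem_nbrs adj_irr /across eqxx /=; lra.
  have [zN|zN] := boolP (z \in N x); have [oz|oz] := boolP (across z) => /=.
  - by lra.
  - by case: (touching z) => /=; have := ut; lra.
  - have -> : facing z; last by rewrite /=; have := cY; lra.
    by apply/hasP; exists w => //; rewrite ow adj_sym -mem_nbrs.
  - by rewrite /r0; lra.
rewrite !big_split /= -!mulr_sumr !sum_indicator sum_const_nbrs count1_nbr //.
have h1 : (count inB (N w))%:R + 1 <= same_deg%:R :> R.
  by rewrite natr1 ler_nat; exact: count_inB.
have h2 : de%:R <= (degree G w)%:R :> R by rewrite ler_nat.
have := ler_wpM2l r0_ge0 h1; have := ler_wpM2l r0_ge0 h2.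
lra.
Qed.

Lemma energyB1 w : w \in N x -> ~~ across w && ~~ touching w ->
  energy w <= 3 * t ^+ 2 - r1 * (de%:R - same_deg%:R)
    + same_deg0%:R * ((2 * t - u) ^+ 2 - t ^+ 2)
    + ((1 + 2 * u) ^+ 2 - u ^+ 2 + r0) * (count inA (N w))%:R
    + ((m + 2 * t) ^+ 2 - t ^+ 2 + r1) * (count farY (N w))%:R.
Proof.
move=> wN /andP[ow tw]; rewrite /energy (testB1 wN ow tw).
apply: (@le_trans _ _ (\sum_(z <- N w) (- r1 + (3 * t ^+ 2 + r1) * (pred1 x z)%:R
   + r1 * (inB z)%:R + ((2 * t - u) ^+ 2 - t ^+ 2) * (inB z && touching z)%:R
   + ((1 + 2 * u) ^+ 2 - u ^+ 2 + r0) * (inA z)%:R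
   + ((m + 2 * t) ^+ 2 - t ^+ 2 + r1) * (farY z)%:R))).
  rewrite big_seq [X in _ <= X]big_seq; apply: ler_sum => z zw.
  rewrite /test /inA /inB /farX /farY /=.
  have [->|zx] := eqVneq z x; first by rewrite mem_nbrs adj_irr /across eqxx /=; lra.
  have [zN|zN] := boolP (z \in N x); have [oz|oz] := boolP (across z) => /=.
  - case/hasP: tw; exists z => //; by rewrite oz -mem_nbrs.
  - by case: (touching z) => /=; lra.
  - have -> : facing z; last by rewrite /=; lra.
    by apply/hasP; exists w => //; rewrite ow adj_sym -mem_nbrs.
  - by rewrite /r1; lra.
rewrite !big_split /= -!mulr_sumr !sum_indicator sum_const_nbrs count1_nbr //.
have h1 : (count inB (N w))%:R + 1 <= same_deg%:R :> R.
  by rewrite natr1 ler_nat; exact: count_inB.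
have h2 : de%:R <= (degree G w)%:R :> R by rewrite ler_nat.
have h3 : (count (fun z => inB z && touching z) (N w))%:R <= same_deg0%:R :> R.
  by rewrite ler_nat; exact: count_B0.
have h4 : 0 <= (2 * t - u) ^+ 2 - t ^+ 2 by rewrite subr_ge0.
have := ler_wpM2l r1_ge0 h1; have := ler_wpM2l r1_ge0 h2; have := ler_wpM2l h4 h3.
lra.
Qed.

Lemma sum_nbrs (g : V -> R) :
  \sum_(y <- N x) g y =
   \sum_(y <- N x | across y) g y
   + (\sum_(y <- N x | ~~ across y && touching y) g y
      + \sum_(y <- N x | ~~ across y && ~~ touching y) g y).
Proof. by rewrite (bigID across) /= [X in _ + X](bigID touching). Qed.

Lemma count_B1 :
  (count (fun z => ~~ across z && ~~ touching z) (N x))%:R =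
    same_deg%:R - same_deg0%:R :> R.
Proof.
rewrite -natrB ?same_deg0_le //; congr (_%:R).
rewrite /same_deg /same_deg0 -!sum1_count (bigID touching (fun z => ~~ across z)) /=.
lia.
Qed.

Lemma sum_test_comp (h : R -> R) : \sum_(y <- N x) h (test y) =
  (cross_deg x)%:R * h 1
  + (same_deg0%:R * h (- u) + (same_deg%:R - same_deg0%:R) * h (- t)).
Proof.
rewrite sum_nbrs.
rewrite -[X in X + _]big_filter -[X in _ + (X + _)]big_filter.
rewrite -[X in _ + (_ + X)]big_filter.
have E (P : pred V) (c : R) (g : V -> R) :
    (forall y, y \in N x -> P y -> g y = c) ->
    \sum_(y <- [seq y <- N x | P y]) g y = (count P (N x))%:R * c.
  move=> hg; rewrite (eq_big_seq (fun=> c)) => [|y].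
    by rewrite big_const_seq count_predT size_filter iter_addr_0 mulr_natl.
  by rewrite mem_filter => /andP[Py yN]; exact: hg.
rewrite (E _ (h 1)) => [|y yN oy]; last by rewrite testA.
rewrite (E _ (h (- u))) => [|y yN /andP[oy ty]]; last by rewrite testB0.
rewrite (E _ (h (- t))) => [|y yN /andP[oy ty]]; last by rewrite testB1.
by rewrite count_B1.
Qed.

Lemma Gamma2_test :
  4 * Gamma2 G test test x <=
  excess (cross_deg x)%:R same_deg%:R same_deg0%:R
    edgesAB%:R edgesAX%:R edgesBY%:R de%:R t u m r.
Proof.
rewrite Gamma2E ?testx //.
rewrite (sum_test_comp (fun v => v ^+ 2)) (sum_test_comp id).
rewrite -cross_same_deg natrD.
rewrite -[\sum_(y <- N x) _]/(\sum_(y <- N x) energy y) sum_nbrs.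
have cstE (P : pred V) (c : R) : \sum_(y <- N x | P y) c = c * (count P (N x))%:R.
  by rewrite big_const_seq iter_addr_0 mulr_natr.
have mono (P : pred V) (g h : V -> R) : (forall y, y \in N x -> P y -> g y <= h y) ->
    \sum_(y <- N x | P y) g y <= \sum_(y <- N x | P y) h y.
  move=> gh; rewrite big_seq_cond [X in _ <= X]big_seq_cond.
  by apply: ler_sum => y /andP[]; exact: gh.
set CA := (1 + 2 * u) ^+ 2 - u ^+ 2 + r0.
set CY := (m + 2 * t) ^+ 2 - t ^+ 2 + r1.
have HA : \sum_(y <- N x | across y) energy y <=
   (3 - de%:R + (cross_deg x)%:R) * (cross_deg x)%:R + (2 + u) ^+ 2 * edgesAB%:R
   + (2 + r) ^+ 2 * edgesAX%:R + (m - 2) ^+ 2 * ((cross_deg x)%:R * edgesBY%:R).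
  apply: le_trans (mono _ _ _ energyA) _.
  (* The constant is generalised so that the sums below do not split it. *)
  move: (3 - de%:R + (cross_deg x)%:R) => k.
  rewrite !big_split /= -!mulr_sumr -!natr_sum cstE lerD2l.
  by apply: ler_wpM2l; [exact: sqr_ge0 | rewrite -natrM ler_nat; exact: count_facing].
have HB0 : \sum_(y <- N x | ~~ across y && touching y) energy y <=
    (3 * u ^+ 2 - r0 * (de%:R - same_deg%:R)) * same_deg0%:R
    + CA * (\sum_(y <- N x | ~~ across y && touching y) (count inA (N y))%:R)
    + CY * (\sum_(y <- N x | ~~ across y && touching y) (count farY (N y))%:R).
  apply: le_trans (mono _ _ _ energyB0) _.
  move: (3 * u ^+ 2 - r0 * (de%:R - same_deg%:R)) => k.
  by rewrite !big_split /= -!mulr_sumr cstE.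
have HB1 : \sum_(y <- N x | ~~ across y && ~~ touching y) energy y <=
    (3 * t ^+ 2 - r1 * (de%:R - same_deg%:R)
     + same_deg0%:R * ((2 * t - u) ^+ 2 - t ^+ 2)) * (same_deg%:R - same_deg0%:R)
    + CA * (\sum_(y <- N x | ~~ across y && ~~ touching y) (count inA (N y))%:R)
    + CY * (\sum_(y <- N x | ~~ across y && ~~ touching y) (count farY (N y))%:R).
  apply: le_trans (mono _ _ _ energyB1) _.
  move: (3 * t ^+ 2 - r1 * (de%:R - same_deg%:R) + _) => k.
  by rewrite !big_split /= -!mulr_sumr cstE count_B1.
have E1 : edgesAB%:R = \sum_(y <- N x | ~~ across y && touching y) (count inA (N y))%:R
  + \sum_(y <- N x | ~~ across y && ~~ touching y) (count inA (N y))%:R :> R.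
  by rewrite -edgesABC natr_sum (bigID touching).
have E3 : edgesBY%:R = \sum_(y <- N x | ~~ across y && touching y) (count farY (N y))%:R
  + \sum_(y <- N x | ~~ across y && ~~ touching y) (count farY (N y))%:R :> R.
  by rewrite /edgesBY natr_sum (bigID touching).
have EA := congr1 (fun v => CA * v) E1; have EY := congr1 (fun v => CY * v) E3.
move: HA HB0 HB1 EA EY; rewrite /= !mulrDr -/r0 -/r1 /excess -/r0 -/r1 -/CA -/CY.
rewrite /=.
lra.
Qed.
End Cut.

(** * Negativity of the bound *)

Section Arith.
Import Order.TTheory GRing.Theory Num.Theory.
Local Open Scope ring_scope.
Variable R : realType.
Implicit Types (a b de t u m r : R).

(** The case a = 1, where c1 = c2 = b0 = 0.  As t b^2 = 1, for the largest de and c3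
the value is t (-8 + 1 + 5tb - 15t/2), and -8 is the derivative in t at 0. *)
Lemma excess1 b (c3 : R) de : 0 <= c3 -> c3 + 3 <= de -> de <= 1 + b ->
  excess 1 b 0 0 0 c3 de (b ^- 2) (b ^- 2 / 2) 1 (3 / 2 * b ^- 2) < 0.
Proof.
move=> c0 h1 h2.
have b2 : 2 <= b by lra.
have bn : b != 0 by lra.
set t := b ^- 2.
have tb : t * b ^+ 2 = 1 by rewrite mulVf // expf_neq0.
have t0 : 0 < t by rewrite invr_gt0 exprn_gt0; lra.
rewrite /excess.
(* e and g measure how far de and c3 are below the extreme values 1 + b and
   de - 3; the expression is decreasing in both. *)
set e := 1 + b - de; set g := de - 3 - c3.
have e0 : 0 <= e by rewrite /e; lra.
have g0 : 0 <= g by rewrite /g; lra.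
have -> : de = 1 + b - e by rewrite /e; ring.
have -> : c3 = b - 2 - e - g by rewrite /g /e; ring.
set X := (X in X < 0).
have -> : X = t * (-8 + t * b^+2 + 5 * (t * b) - 15/2 * t)
   - e * (1 + 4 * t + 15/4 * t ^+ 2 - 3/4 * b * t ^+ 2)
   - g * (2 + 4 * t + 15/4 * t ^+ 2).
  by rewrite /X; field.
rewrite tb.
have tb1 : t * b <= 1/2 by nra.
have t4 : t <= 1/4 by nra.
have p1 : t * (-8 + 1 + 5 * (t * b) - 15/2 * t) < 0.
  by rewrite pmulr_rlt0 //; lra.
have p2 : 0 <= e * (1 + 4 * t + 15/4 * t ^+ 2 - 3/4 * b * t ^+ 2).
  by apply: mulr_ge0 => //; nra.
have p3 : 0 <= g * (2 + 4 * t + 15/4 * t ^+ 2).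
  by apply: mulr_ge0 => //; nra.
lra.
Qed.

(** The case a = 2.  Again the extreme values of de and c3 are the worst ones; then,
for each of the finitely many triples (b0, c1, c2), multiplying by b^2 gives a cubic
in h = b - 2 - c1 - c2 all of whose coefficients are negative. *)
Lemma excess2 b (b0 c1 c2 : nat) (c3 : R) de :
  (b0 <= c1)%N -> (c1 + c2 <= 2)%N -> b0%:R <= b ->
  0 <= c3 -> c1%:R + c2%:R + c3 + 4 <= de -> de <= 2 + b ->
  excess 2 b b0%:R c1%:R c2%:R c3 de (2 / b) (2 / b / 2) 1 (3 / 2 * (2 / b)) < 0.
Proof.
move=> hb0 hc12 hb0b hc3 h1 h2.
have b2 : 2 <= b by have := ler0n R c1; have := ler0n R c2; lra.
have bn : b != 0 by lra.
set e := 2 + b - de; set g := de - 4 - c1%:R - c2%:R - c3.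
have e0 : 0 <= e by rewrite /e; lra.
have g0 : 0 <= g by rewrite /g; lra.
(* The argument h of the cubic is e + g + c3, hence nonnegative. *)
have hh : 0 <= b - 2 - c1%:R - c2%:R.
  by rewrite (_ : _ - c2%:R = e + g + c3); [lra|rewrite /e /g; ring].
rewrite -(pmulr_llt0 (x := b ^+ 2)) ?exprn_gt0 //; last lra.
set P := (b ^+ 2 * excess 2 b b0%:R c1%:R c2%:R (b - 2 - c1%:R - c2%:R) (2 + b)
            (2 / b) (2 / b / 2) 1 (3 / 2 * (2 / b))).
have -> : excess 2 b b0%:R c1%:R c2%:R c3 de
    (2 / b) (2 / b / 2) 1 (3 / 2 * (2 / b)) * b ^+ 2 =
   P - e * (b ^+ 2 + 8 * b + 15 - 3 * (b - b0%:R))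
      - g * (3 * b ^+ 2 + 8 * b + 15).
  by rewrite /P /e /g /excess; field.
have p2 : 0 <= e * (b ^+ 2 + 8 * b + 15 - 3 * (b - b0%:R)).
  by apply: mulr_ge0 => //; have := ler0n R b0; nra.
have p3 : 0 <= g * (3 * b ^+ 2 + 8 * b + 15).
  by apply: mulr_ge0 => //; nra.
suff : P < 0 by lra.
clear p2 p3 h1 h2 hc3; clearbody e g; clear e g e0 g0.
have -> : P =
  b ^+ 2 * (10 - 4 * b + 5 * c1%:R + 4 * c2%:R + 3 * (b - 2 - c1%:R - c2%:R))
  + 2 * b * (4 * c1%:R + 6 * c2%:R + 4 * (b - 2 - c1%:R - c2%:R)
             - 8 * (b - b0%:R / 2))
  + (4 * c1%:R + 9 * c2%:R + 3 * b0%:R + (b - b0%:R) * (6 + 5 * b0%:R)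
     + 15 * (b - 2 - c1%:R - c2%:R) - (2 + b) * (4 * b - 3 * b0%:R)
     + 8 * (b - b0%:R / 2) ^+ 2).
  by rewrite /P /excess; field.
clear P; set h := b - 2 - c1%:R - c2%:R in hh *.
have -> : b = h + 2 + c1%:R + c2%:R by rewrite /h; ring.
have hh2 : 0 <= h ^+ 2 by exact: sqr_ge0.
have hh3 : 0 <= h ^+ 3 by exact: exprn_ge0.
clearbody h; move: hb0 hc12; clear -hh hh2 hh3.
case: c1 => [|[|[|c1]]]; case: c2 => [|[|[|c2]]] //;
  case: b0 => [|[|[|b0]]] // _ _; lra.
Qed.

(** The case a >= 3.  The value of b0 is immaterial, since u = t.  Each of the edges
counted by c1 + c2 + c3 costs at most 5 (1 + a/b)^2. *)
Lemma excess3 a b (b0 c1 c2 c3 : R) de : 3 <= a ->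
  0 <= c1 -> 0 <= c2 -> 0 <= c3 -> a + c1 + c2 + c3 + 2 <= de -> de <= a + b ->
  excess a b b0 c1 c2 c3 de (a / b) (a / b) 2 (2 * (a / b)) < 0.
Proof.
move=> a3 p1 p2 p3 h1 h2.
have b2 : 2 <= b by lra.
have bn : b != 0 by lra.
rewrite -(pmulr_llt0 (x := b ^+ 2)) ?exprn_gt0 //; last lra.
have -> : excess a b b0 c1 c2 c3 de (a / b) (a / b) 2 (2 * (a / b)) * b ^+ 2
  = a * b * ((a + b) * (3 - de) - a ^+ 2 - b ^+ 2) + 5 * (c1 + c2 + c3) * (a + b) ^+ 2
    - c1 * (2 * a * b) - (c2 + c3) * (a + b) ^+ 2.
  by rewrite /excess; field.
have d2 : 0 <= (a + b) ^+ 2 by exact: sqr_ge0.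
have q1 : 0 <= c1 * (2 * a * b) by apply: mulr_ge0 => //; nra.
have q2 : 0 <= (c2 + c3) * (a + b) ^+ 2 by apply: mulr_ge0 => //; lra.
have q3 : (c1 + c2 + c3) * (a + b) ^+ 2 <= (de - 2 - a) * (a + b) ^+ 2.
  by apply: ler_wpM2r => //; lra.
suff : a * b * ((a + b) * (3 - de) - a ^+ 2 - b ^+ 2)
       + 5 * (de - 2 - a) * (a + b) ^+ 2 < 0 by lra.
(* The expression is affine in de, so it suffices to bound it at the two ends
   de = a + 2 and de = a + b of the range of de. *)
have l1 : a * b * ((a + b) * (1 - a) - a ^+ 2 - b ^+ 2) < 0.
  by rewrite pmulr_rlt0; nra.
have l2 : a * b * (3 * (a + b) - 2 * (a ^+ 2 + a * b + b ^+ 2))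
          + 5 * (b - 2) * (a + b) ^+ 2 < 0.
  set k := a - 3; set h := b - 2.
  have k0 : 0 <= k by rewrite /k; lra.
  have h0 : 0 <= h by rewrite /h; lra.
  have -> : a = k + 3 by rewrite /k; ring.
  have -> : b = h + 2 by rewrite /h; ring.
  (* In k and h, the only monomial with a positive coefficient is 5 h^2, which H3
     absorbs. *)
  have H i j : 0 <= k ^+ i * h ^+ j by rewrite mulr_ge0 ?exprn_ge0.
  have H3 : 0 <= h * (h ^+ 2 - 5 * h + 10).
    by apply: mulr_ge0 => //; have := sqr_ge0 (h - 5 / 2); lra.
  have := (H 1 0, H 1 1, H 1 2, H 1 3, H 2 0, H 2 1, H 2 2, H 3 0, H 3 1)%N.
  move=> [[[[[[[[? ?] ?] ?] ?] ?] ?] ?] ?].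
  lra.
case: (lerP 0 ((a + b) * (a * b - 5 * (a + b)))) => hs.
  have := mulr_ge0 (_ : 0 <= de - 2 - a) hs.
  move=> /(_ ltac:(lra)) q4; nra.
have q4 : 0 <= (a + b - de) * - ((a + b) * (a * b - 5 * (a + b))).
  apply: mulr_ge0; lra.
nra.
Qed.

End Arith.

(** * Small cuts are trivial *)

Section Main.
Import Order.TTheory GRing.Theory Num.Theory.
Local Open Scope ring_scope.
Variables (R : realType) (V : choiceType) (G : graph V).
Variable de : nat.
Hypothesis hde : forall y, (de <= degree G y)%N.

(** The test function for a <= 2. *)
Lemma Gamma2_sloped (S : pred V) (x : V) (t : R) : 0 <= t ->
  4 * Gamma2 G (test G S x t (t / 2) 1 (3 / 2 * t))
        (test G S x t (t / 2) 1 (3 / 2 * t)) x <=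
  excess (cross_deg G S x)%:R (same_deg G S x)%:R (same_deg0 G S x)%:R
    (edgesAB G S x)%:R (edgesAX G S x)%:R (edgesBY G S x)%:R de%:R t (t / 2) 1 (3 / 2 * t).
Proof. by move=> t0; apply: Gamma2_test => //; have := sqr_ge0 t; nra. Qed.

(** The test function for a >= 3. *)
Lemma Gamma2_steep (S : pred V) (x : V) (t : R) : 0 <= t ->
  4 * Gamma2 G (test G S x t t 2 (2 * t)) (test G S x t t 2 (2 * t)) x <=
  excess (cross_deg G S x)%:R (same_deg G S x)%:R (same_deg0 G S x)%:R
    (edgesAB G S x)%:R (edgesAX G S x)%:R (edgesBY G S x)%:R de%:R t t 2 (2 * t).
Proof. by move=> t0; apply: Gamma2_test => //; have := sqr_ge0 t; nra. Qed.

Hypothesis hcurv : forall (f : V -> R) x, 0 <= Gamma2 G f f x.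

(** If all degrees are at least de, Gamma_2 is nonnegative and the edges leaving S lie
in a set of at most de - 2 edges, then no edge leaves S. *)
Lemma small_cut_trivial (S : pred V) (F : {fset {fset V}}) :
  (forall y z, adj G y z -> S y != S z -> [fset y; z]%fset \in F) ->
  (#|` F|%fset + 2 <= de)%N ->
  forall y z, adj G y z -> S y = S z.
Proof.
move=> hF hk y0 z0 yz0; apply/eqP/negPn/negP => syz0.
have bound v : (cross_deg G S v <= #|` F|%fset)%N.
  by have := cut_card v hF; lia.
have exc : exists n, `[< exists v, cross_deg G S v = n >].
  by exists (cross_deg G S y0); apply/asboolP; exists y0.
have ubc n : `[< exists v, cross_deg G S v = n >] -> (n <= #|` F|%fset)%N.
  by move=> /asboolP[v <-].
case: (ex_maxnP exc ubc) => a /asboolP[x xa] amax.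
have hmax y : (cross_deg G S y <= cross_deg G S x)%N.
  by rewrite xa; apply: amax; apply/asboolP; exists y.
have a_gt0 : (0 < cross_deg G S x)%N.
  apply: leq_trans (hmax y0); rewrite -has_count; apply/hasP; exists z0.
    by rewrite mem_nbrs.
  by rewrite eq_sym.
have kF := cut_card x hF.
have c12 := edgesA_le (fun y _ => hmax y).
have b01 := same_deg0_le_edgesAB G S x.
have b0b := same_deg0_le G S x.
have dx := hde x; rewrite -(cross_same_deg G S x) in dx.
have G1 := fun t => Gamma2_sloped S x (t := t).
have G2 := fun t => Gamma2_steep S x (t := t).
clear amax ubc exc bound.
move: a_gt0 kF c12 b01 b0b dx G1 G2; clear xa hmax.
move: (cross_deg G S x) (same_deg G S x) (same_deg0 G S x).
move: (edgesAB G S x) (edgesAX G S x) (edgesBY G S x).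
move=> c1 c2 c3 {}a b b0 a0 kF c12 b01 b0b dx G1 G2.
have b0' : 0 <= b%:R :> R by [].
have H2 : (a%:R + c1%:R + c2%:R + c3%:R + 2 <= de%:R :> R).
  by rewrite -!natrD ler_nat; lia.
have H3 : de%:R <= a%:R + b%:R :> R by rewrite -natrD ler_nat.
(* In each case 0 <= 4 Gamma_2(f)(x) <= excess < 0. *)
have [a3|a3] := leqP 3 a.
  have Q := le_trans (mulr_ge0 (ler0n _ 4) (hcurv _ _))
                     (G2 _ (divr_ge0 (ler0n R a) b0')).
  suff /(le_lt_trans Q) : excess a%:R b%:R b0%:R c1%:R c2%:R c3%:R de%:R
     (a%:R / b%:R) (a%:R / b%:R) 2 (2 * (a%:R / b%:R)) < 0 :> R by rewrite ltxx.
  by apply: excess3 => //; rewrite ler_nat.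
have [a2|a1] := leqP 2 a.
  have ? : a = 2%N by lia. subst a.
  have Q := le_trans (mulr_ge0 (ler0n _ 4) (hcurv _ _))
                     (G1 _ (divr_ge0 (ler0n R 2) b0')).
  suff /(le_lt_trans Q) : excess 2 b%:R b0%:R c1%:R c2%:R c3%:R de%:R (2 / b%:R)
     (2 / b%:R / 2) 1 (3 / 2 * (2 / b%:R)) < 0 :> R by rewrite ltxx.
  by apply: excess2 => //; rewrite ?ler_nat //; lra.
have [? ? ? ?] : [/\ a = 1%N, b0 = 0%N, c1 = 0%N & c2 = 0%N] by split; nia.
subst a b0 c1 c2.
have tp : 0 <= b%:R ^- 2 :> R by rewrite invr_ge0 exprn_ge0.
have Q := le_trans (mulr_ge0 (ler0n _ 4) (hcurv _ _)) (G1 _ tp).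
suff /(le_lt_trans Q) : excess 1 b%:R 0 0 0 c3%:R de%:R (b%:R ^- 2)
   (b%:R ^- 2 / 2) 1 (3 / 2 * b%:R ^- 2) < 0 :> R by rewrite ltxx.
by apply: excess1 => //; lra.
Qed.
End Main.

Theorem theorem1p3 (R : realType) (V : choiceType) (G : graph V) (delta : nat)
    (hconn : graph_connected G) (hdelta : is_min_degree G delta)
    (hcurv : (0%:E <= curvature R G)%E) :
  edge_connected G (delta - 1).
Proof.
have [[x0 dx0] hde] := hdelta; split=> [_ F _ hF|triv]; last first.
  suff -> : delta = 0 by [].
  rewrite -dx0 -size_nbrs; case E: (nbrs G x0) => [|y s] //.
  by have := mem_head y s; rewrite -E mem_nbrs (triv y x0) adj_irr.
move=> u v; apply: contrapT => nuv.
(* S is the component of u in G - F. *)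
pose S z := `[< exists2 p, path (adj (del_edges G F)) u p & last u p = z >].
have hS y z : adj G y z -> S y = S z.
  apply: (small_cut_trivial hde (curvature_ge0_Gamma2 hcurv) (F := F)); last by lia.
  move=> {}y {}z yz Syz; apply: contrapT => /negP nF.
  have step a b : adj G a b -> [fset a; b]%fset \notin F -> S a -> S b.
    move=> ab nab /asboolP[p pp lp]; apply/asboolP; exists (rcons p b).
      by rewrite rcons_path pp lp /= /del_adj ab.
    by rewrite last_rcons.
  move/negP: Syz; apply; apply/eqP; apply/idP/idP.
    exact: step.
  by apply: step; rewrite 1?adj_sym 1?fsetUC.
have [p pp lp] := hconn u v.
apply: nuv; apply/asboolP; rewrite -/(S v) -lp.
have : S u by apply/asboolP; exists [::].
elim: p (u) pp {lp} => //= z p IH w /andP[wz zp] Sw.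
by apply: IH zp _; rewrite -(hS _ _ wz).
Qed.
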